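(* Let $q$ and $k\geq 3$ be integers where $q$ is prime, and let $I$ be an instance of $\mathsf{k\,CSP}(\mathcal{E}_q)$ with strong chromatic number $\nu\geq k$. Then: (i) If $q=2$ and $k$ is odd, the average differential ratio on $I$ is at least - $1/2^{k-1}$ if $\nu\leq k+1$; - $1/(2\lceil\nu/2\rceil)$ (which is asymptotically equivalent to $1/\nu$) if $k=3$; - $1/2^{\lceil\log_2\nu\rceil(k-1)/2}\geq 1/(2\nu)^{\lfloor k/2\rfloor}$ if $k\geq 5$. (ii) If $q\geq 3$, this ratio is bounded below by $$\frac{1}{q^{\lceil\log_q\nu\rceil(k-\lceil\log_q k\rceil)}}\ \geq\ \frac{1}{(q\nu)^{k-\lceil\log_q k\rceil}}.$$
   Context: Let $\Sigma_q=\{0,1,\ldots,q-1\}$, with arithmetic modulo $q$, and $[n]=\{1,\ldots,n\}$. An instance $I$ of $\mathsf{k\,CSP\!-\!q}$ consists of integers $n,m\ge 1$, a goal (maximize or minimize) and, for each $i\in[m]$, a weight $w_i>0$, an integer $1\le k_i\leq \min\{k,n\}$, a strictly increasing sequence $J_i=(i_1,\ldots,i_{k_i})$ of indices of $[n]$, and a function $P_i:\Sigma_q^{k_i}\to\mathbb{R}$. Solutions are vectors $x\in\Sigma_q^n$, with value $v(I,x)=\sum_{i=1}^m w_iP_i(x_{i_1},\ldots,x_{i_{k_i}})$. $\mathrm{opt}(I)$ and $\mathrm{wor}(I)$ are the best and worst solution values (maximum and minimum of $v(I,\cdot)$ if maximizing, minimum and maximum if minimizing). The average differential ratio on $I$ is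 $(\mathbb{E}_X[v(I,X)]-\mathrm{wor}(I))/(\mathrm{opt}(I)-\mathrm{wor}(I))$ with $X$ uniform on $\Sigma_q^n$ (considered when $\mathrm{opt}(I)\neq\mathrm{wor}(I)$). The strong chromatic number of $I$ is the smallest $\nu$ such that there is a partition of $[n]$ into $\nu$ sets such that each $J_i$ contains at most one index from each set. A function $P:\Sigma_q^h\to\mathbb{R}$ belongs to $\mathcal{E}_q$ iff $P(y_1+a,\ldots,y_h+a)=P(y_1,\ldots,y_h)$ for all $y\in\Sigma_q^h$ and $a\in\Sigma_q$. $\mathsf{k\,CSP}(\mathcal{E}_q)$ is the restriction of $\mathsf{k\,CSP\!-\!q}$ to instances with all $P_i\in\mathcal{E}_q$. *)

(* Defs.v *)
From HB Require Import structures.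
From mathcomp Require Import all_boot all_order all_algebra.
From mathcomp Require Import reals.

Set Implicit Arguments.
Unset Strict Implicit.
Unset Printing Implicit Defensive.

Import Order.TTheory GRing.Theory Num.Theory.
Local Open Scope ring_scope.

(* Sigma_q is rendered as 'Z_q, which has exactly q elements only when 1 < q. *)

Inductive goal := Maximize | Minimize.

Record csp_instance (R : realType) (q k : nat) := CspInstance {
  csp_n : nat;
  csp_m : nat;
  csp_goal : goal;
  csp_w : 'I_csp_m -> R;
  csp_arity : 'I_csp_m -> nat;
  csp_J : forall i : 'I_csp_m, (csp_arity i).-tuple 'I_csp_n;
  csp_P : forall i : 'I_csp_m, {ffun 'I_(csp_arity i) -> 'Z_q} -> R;
  csp_n_gt0 : (0 < csp_n)%N;
  csp_m_gt0 : (0 < csp_m)%N;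
  csp_w_gt0 : forall i, 0 < csp_w i;
  csp_arity_bounds : forall i, (1 <= csp_arity i <= minn k csp_n)%N;
  csp_J_increasing :
    forall i, sorted (fun a b : 'I_csp_n => (a < b)%N) (csp_J i)
}.

Section Csp.
Variables (R : realType) (q k : nat) (I : csp_instance R q k).

Definition solution := {ffun 'I_(csp_n I) -> 'Z_q}.

Definition value (x : solution) : R :=
  \sum_(i < csp_m I)
    csp_w i * csp_P (i := i) [ffun j => x (tnth (csp_J i) j)].

Definition max_value : R :=
  \big[Num.max/value [ffun=> 0]]_(x : solution) value x.

Definition min_value : R :=
  \big[Num.min/value [ffun=> 0]]_(x : solution) value x.

Definition opt : R :=
  if csp_goal I is Maximize then max_value else min_value.

Definition wor : R :=
  if csp_goal I is Maximize then min_value else max_value.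

Definition mean_value : R :=
  (\sum_(x : solution) value x) / #|{: solution}|%:R.

(* Meaningful only when opt != wor. *)
Definition average_differential_ratio : R :=
  (mean_value - wor) / (opt - wor).

Definition strong_coloring (V : {set {set 'I_(csp_n I)}}) : bool :=
  partition V [set: 'I_(csp_n I)] &&
  [forall i : 'I_(csp_m I), [forall (B | B \in V),
    #|[set c in csp_J i] :&: B| <= 1]]%N.

Definition strongly_colorable (nu : nat) : bool :=
  [exists V, strong_coloring V && (#|V| == nu)].

Lemma strongly_colorable_ex : exists nu, strongly_colorable nu.
Proof.
pose V := [set [set c] | c : 'I_(csp_n I)].
exists #|V|; apply/existsP; exists V; rewrite eqxx andbT; apply/andP; split.
  apply/and3P; split.
  - apply/eqP/setP=> c; rewrite inE; apply/bigcupP.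
    by exists [set c]; rewrite ?set11 // imset_f.
  - apply/trivIsetP=> _ _ /imsetP[a _ ->] /imsetP[b _ ->] neq_ab.
    by rewrite disjoints1 inE; apply: contra neq_ab => /eqP ->.
  - by apply/imsetP=> -[c _ /setP/(_ c)]; rewrite !inE eqxx.
apply/forallP=> i; apply/forall_inP=> _ /imsetP[c _ ->].
by rewrite -(cards1 c) subset_leq_card // subsetIr.
Qed.

Definition strong_chromatic_number : nat := ex_minn strongly_colorable_ex.

End Csp.

(* Membership of P in the class E_q. *)
Definition shift_invariant (R : realType) (q h : nat)
    (P : {ffun 'I_h -> 'Z_q} -> R) : Prop :=
  forall (y : {ffun 'I_h -> 'Z_q}) (a : 'Z_q), P [ffun j => y j + a] = P y.

Definition csp_Eq (R : realType) (q k : nat) (I : csp_instance R q k) : Prop :=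
  forall i : 'I_(csp_m I), shift_invariant (@csp_P R q k I i).

(* Main.v *)
From HB Require Import structures.
Require Import Defs.
From mathcomp Require Import all_boot all_order all_algebra all_fingroup all_field.
From mathcomp Require Import ring lra zify.
From mathcomp Require Import classical_sets functions reals topology normedtype landau.

Import Order.TTheory GRing.Theory Num.Theory.
Import VectorInternalTheory.
Import numFieldNormedType.Exports.
Local Open Scope classical_set_scope.
Local Open Scope ring_scope.

(** Colour the variables so that every constraint sees pairwise distinct
    colours, and consider a weighted family of rows indexed by the colours, with
    entries in Z/q. Translating an optimal solution by a row (a variable is
    translated by the entry at its colour) gives another solution. If the family
    is [balanced], that is, if on any at most k colours it averages every
    shift-invariant function as the uniform distribution does, then the weighted
    mean of the values of these translates is the expected value of a uniformly
    random solution. When the zero row has weight w, the optimum itself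
    contributes w to that mean and everything else is at least as good as the
    worst value, so the average differential ratio is at least w
    ([ratio_ge]). All bounds come from exhibiting balanced families.

    A linear family is given by one point of F_q^r per colour, its rows being the
    values of all linear forms at these points, each of weight q^-r. It is
    balanced as soon as any k of the points are affinely independent
    ([balanced_affinely_free]): affine rather than linear independence is enough
    since the functions are invariant under adding constants, and this is what
    saves a factor q. Two configurations of points are used.

    - For q = 2 and k odd, the k + 1 points made of the origin, the basis vectors
      and the all-one vector of F_2^(k-1) have the single affine relation that
      involves them all ([parity_points_free]).

    - Identify the colours with elements of the field K with q^s elements,
      where s is the least exponent with nu <= q^s, and send a to its powers
      a^j, 0 < j < k. By interpolation any k such points are affinely
      independent over K. Over the prime field F_q, a relation between the j-th
      powers implies the one between the (qj)-th powers by raising it to the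
      power q, so the multiples of q can be dropped from the exponents
      ([bch_points_free]). This leaves k - 1 - floor((k - 1)/q) coordinates in K,
      which is (k - 1)/2 for q = 2 and at most k - ceil(log_q k) in general.

    For q = 2 and k = 3, being balanced only means that any two columns are
    uncorrelated ([balanced_of_correlations]), since a function of three bits that
    is invariant under complementation is an affine combination of the products
    of two of the three signs. Let n be the even number nu or nu + 1. A random row
    with as many zeros as ones has pairwise correlations -1/(n - 1), which a zero
    row of weight 1/n compensates exactly ([half_rows_balanced]). *)

(** * Means and balanced families *)

Section Mean.
Variable R : numFieldType.

Definition mean (T : finType) (F : T -> R) : R := (\sum_t F t) / #|T|%:R.

(** All fibres of a surjective morphism of finite groups have the same size. *)
Lemma mean_surj (U W : finZmodType) (f : U -> W) (F : W -> R) :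
    {morph f : u v / u + v} -> (forall y, exists u, f u = y) ->
  mean U (fun u => F (f u)) = mean W F.
Proof.
move=> fD f_surj.
have card_neq0 (V : finZmodType) : #|V|%:R != 0 :> R.
  by rewrite pnatr_eq0 -lt0n; apply/card_gt0P; exists 0.
have trans y : \sum_u F (f u + y) = \sum_u F (f u).
  have [v <-] := f_surj y.
  rewrite [RHS](reindex_inj (addIr v)).
  by apply: eq_bigr => u _; rewrite fD.
have : \sum_y \sum_u F (f u + y) = \sum_(u : U) \sum_y F y.
  rewrite exchange_big; apply: eq_bigr => u _.
  by rewrite [RHS](reindex_inj (addrI (f u))).
under eq_bigr do rewrite trans.
rewrite !sumr_const -mulr_natr -[RHS]mulr_natr /mean => E.
apply/eqP; rewrite eqr_div ?card_neq0 //; exact/eqP.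
Qed.

End Mean.
Arguments mean {R T} F.

(** Lets [mean_surj] be used with groups of finite functions. *)
HB.instance Definition _ (aT : finType) (rT : finZmodType) :=
  GRing.Zmodule.on {ffun aT -> rT}.

(** A weighted analogue of an orthogonal array (or difference scheme) of strength
    k: uniformity is only asked against shift-invariant functions. *)
Definition balanced (R : realType) (q k : nat) (C T : finType)
    (w : T -> R) (x : T -> C -> 'Z_q) : Prop :=
  [/\ forall t, 0 <= w t, \sum_t w t = 1 &
      forall h (c : 'I_h -> C) (P : {ffun 'I_h -> 'Z_q} -> R), (h <= k)%N ->
      injective c -> shift_invariant P ->
      \sum_t w t * P [ffun j => x t (c j)] = mean P].
Arguments balanced {R q} k {C T} w x.

(** * From balanced families to ratio bounds *)

Section Instances.
Variables (R : realType) (q k : nat) (I : csp_instance R q k).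

Lemma value_le_max (x : solution I) : value x <= max_value I.
Proof. exact: le_bigmax. Qed.

Lemma min_le_value (x : solution I) : min_value I <= value x.
Proof. exact: bigmin_le. Qed.

Lemma max_value_attained : exists x : solution I, value x = max_value I.
Proof.
rewrite /max_value; elim/big_ind: _ => [||x _]; first by eexists.
  by move=> a b [x xa] [y yb]; case: (leP a b) => _; [exists y | exists x].
by exists x.
Qed.

Lemma min_value_attained : exists x : solution I, value x = min_value I.
Proof.
rewrite /min_value; elim/big_ind: _ => [||x _]; first by eexists.
  by move=> a b [x xa] [y yb]; case: (leP a b) => _; [exists x | exists y].
by exists x.
Qed.

Lemma csp_J_inj (i : 'I_(csp_m I)) : injective (tnth (csp_J i)).
Proof.
apply/tuple_uniqP; apply: sorted_uniq (csp_J_increasing i).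
  by move=> b a c; apply: ltn_trans.
by move=> a; rewrite /= ltnn.
Qed.

(** Blocks of an optimal strong colouring are numbered, and the numbers injected
    into [C]. *)
Lemma rainbow_coloring (C : finType) : (strong_chromatic_number I <= #|C|)%N ->
  exists f : 'I_(csp_n I) -> C, forall i : 'I_(csp_m I), {in csp_J i &, injective f}.
Proof.
rewrite /strong_chromatic_number; case: ex_minnP => nu + _ le_nu.
case/existsP=> V /andP[/andP[/and3P[/eqP covV _ _] /forallP strongV] /eqP cardV].
have blockV c : finset.pblock V c \in V by rewrite finset.pblock_mem // covV.
have mem_block c : c \in finset.pblock V c by rewrite finset.mem_pblock covV inE.
have c0 : 'I_(csp_n I) := Ordinal (csp_n_gt0 I).
rewrite -cardV in le_nu.
exists (fun c => enum_val (widen_ord le_nu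
                   (enum_rank_in (blockV c0) (finset.pblock V c)))).
move=> i a b aJ bJ /enum_val_inj /(congr1 val) /= eq_rank.
have eq_block : finset.pblock V a = finset.pblock V b.
  apply: (can_in_inj (enum_rankK_in (blockV c0))) => //; exact: val_inj.
have /forall_inP/(_ _ (blockV a))/card_le1_eqP := strongV i.
by apply; rewrite !inE ?aJ ?bJ /= ?mem_block // eq_block.
Qed.

(** A constraint reads distinct variables, so that a uniform solution induces a
    uniform input on it. *)
Lemma mean_value_sum : mean_value I = \sum_i csp_w i * mean (@csp_P _ _ _ I i).
Proof.
rewrite /mean_value /value exchange_big mulr_suml; apply: eq_bigr => i _.
rewrite -mulr_sumr -mulrA; congr (_ * _).
apply: (@mean_surj _ _ _ (fun x : solution I => [ffun j => x (tnth (csp_J i) j)])).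
  by move=> x y; apply/ffunP=> j; rewrite !ffunE.
move=> z; exists [ffun a => if [pick j | tnth (csp_J i) j == a] is Some j then z j else 0].
apply/ffunP=> j; rewrite !ffunE; case: pickP => [j' /eqP/csp_J_inj-> //|].
by move/(_ j); rewrite eqxx.
Qed.

Hypothesis hE : csp_Eq I.

Section Design.
Variables (C T : finType) (w : T -> R) (x : T -> C -> 'Z_q).
Variable f : 'I_(csp_n I) -> C.
Hypothesis f_rainbow : forall i : 'I_(csp_m I), {in csp_J i &, injective f}.
Hypothesis bal : balanced k w x.

Definition translate (s : solution I) (t : T) : solution I :=
  [ffun a => s a + x t (f a)].

(** Around [s], a constraint function stays shift-invariant, and it reads
    distinct colours: balancedness applies to each constraint separately. *)
Lemma value_translates s : \sum_t w t * value (translate s t) = mean_value I.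
Proof.
have [_ _ balP] := bal; rewrite mean_value_sum /value.
under eq_bigr do rewrite mulr_sumr.
rewrite exchange_big; apply: eq_bigr => i _.
under eq_bigr do rewrite mulrCA.
rewrite -mulr_sumr; congr (_ * _).
pose s0 := [ffun j => s (tnth (csp_J i) j)].
pose P z := @csp_P _ _ _ I i (s0 + z).
transitivity (mean P); last first.
  rewrite /mean; congr (_ / _).
  by rewrite [RHS](reindex_inj (addrI s0)).
have h_le : (csp_arity i <= k)%N.
  by have := csp_arity_bounds i; rewrite leq_min => /and3P[].
rewrite -(balP _ (fun j => f (tnth (csp_J i) j))) //.
- apply: eq_bigr => t _; congr (_ * @csp_P _ _ _ I i _).
  by apply/ffunP=> j; rewrite !ffunE.
- by move=> j j' /(f_rainbow i _ _ (mem_tnth _ _) (mem_tnth _ _))/csp_J_inj.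
- move=> y a; rewrite /P -(hE i (s0 + y) a); congr (@csp_P _ _ _ I i _).
  by apply/ffunP=> j; rewrite !ffunE addrA.
Qed.

(** Translating an optimal solution, row [t0] gives back the optimum, and the other
    rows give values bounded by the worst one. *)
Lemma ratio_ge_of_rainbow t0 :
  opt I != wor I -> x t0 =1 (fun=> 0) -> w t0 <= average_differential_ratio I.
Proof.
move=> hI xt0; have [w_ge0 w_sum _] := bal.
have trans0 s : translate s t0 = s.
  by apply/ffunP=> a; rewrite ffunE xt0 addr0.
have rest v : \sum_(t | t != t0) w t * v = (1 - w t0) * v.
  by rewrite -mulr_suml -w_sum (bigD1 t0 (P:=predT)) //= [w t0 + _]addrC addrK.
have mean_split s : mean_value I =
    w t0 * value s + \sum_(t | t != t0) w t * value (translate s t).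
  by rewrite -(value_translates s) (bigD1 t0) //= trans0.
move: hI; rewrite /average_differential_ratio /opt /wor.
case: (csp_goal I) => hI.
- have [s sE] := max_value_attained.
  have lt_v : 0 < max_value I - min_value I.
    rewrite subr_gt0 lt_neqAle eq_sym hI.
    exact: le_trans (min_le_value s) (value_le_max s).
  rewrite ler_pdivlMr // (mean_split s) sE.
  have : (1 - w t0) * min_value I <=
      \sum_(t | t != t0) w t * value (translate s t).
    rewrite -rest; apply: ler_sum => t _.
    by rewrite ler_wpM2l ?w_ge0 ?min_le_value.
  by lra.
- have [s sE] := min_value_attained.
  have lt_v : min_value I - max_value I < 0.
    rewrite subr_lt0 lt_neqAle hI.
    exact: le_trans (min_le_value s) (value_le_max s).
  rewrite ler_ndivlMr // (mean_split s) sE.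
  have : \sum_(t | t != t0) w t * value (translate s t) <=
      (1 - w t0) * max_value I.
    rewrite -rest; apply: ler_sum => t _.
    by rewrite ler_wpM2l ?w_ge0 ?value_le_max.
  by lra.
Qed.

End Design.

Lemma ratio_ge (C T : finType) (w : T -> R) (x : T -> C -> 'Z_q) t0 :
    opt I != wor I -> (strong_chromatic_number I <= #|C|)%N ->
    balanced k w x -> x t0 =1 (fun=> 0) ->
  w t0 <= average_differential_ratio I.
Proof.
move=> hI /rainbow_coloring[f f_rainbow] bal xt0.
exact: ratio_ge_of_rainbow f_rainbow bal _ hI xt0.
Qed.

End Instances.

(** * Linear families *)

Section Affine.
Variables (q : nat) (C : finType) (r : nat) (pt : C -> 'rV['F_q]_r).

(** Any at most [k] of the points are affinely independent, where the affine
    relations are extended by zero to coefficients on all of [C]. *)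
Definition affinely_free (k : nat) : Prop :=
  forall u : C -> 'F_q, (#|[pred c | u c != 0%R]| <= k)%N ->
    \sum_c u c = 0 -> \sum_c u c *: pt c = 0 -> forall c, u c = 0.

(** Prefixing points by the coordinate 1 turns affine independence into linear
    independence. *)
Lemma affine_extension_row_free k h (c : 'I_h -> C) :
    affinely_free k -> (h <= k)%N -> injective c ->
  row_free (\matrix_(j < h) row_mx (const_mx 1 : 'rV_1) (pt (c j))).
Proof.
move=> free_k le_hk c_inj; rewrite -kermx_eq0; apply/eqP/row_matrixP=> i.
rewrite row0; have /sub_kermxP := row_sub i (kermx (\matrix_(j < h) row_mx (const_mx 1 : 'rV_1) (pt (c j)))).
move: (row i _) => y; rewrite mulmx_sum_row.
under eq_bigr do rewrite rowK scale_row_mx.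
pose u a : 'F_q := \sum_(j | c j == a) y 0 j.
have u_c j : u (c j) = y 0 j.
  by rewrite /u (big_pred1 j) // => j'; rewrite /= (inj_eq c_inj).
have sumZ (V : lmodType 'F_q) (F : C -> V) :
    \sum_a u a *: F a = \sum_j y 0 j *: F (c j).
  under eq_bigr do rewrite scaler_suml.
  rewrite (exchange_big_dep xpredT) //=; apply: eq_bigr => j _.
  by under eq_bigl do rewrite eq_sym; rewrite big_pred1_eq.
move=> E.
have {}E : row_mx (\sum_j y 0 j *: const_mx 1 : 'rV['F_q]_1)
    (\sum_j y 0 j *: pt (c j)) = row_mx 0 0.
  rewrite row_mx0 -[RHS]E; symmetry.
  elim/big_rec3: _ => [|j a b d _ ->]; first by rewrite row_mx0.
  by rewrite add_row_mx.
have [E1 E2] := eq_row_mx E.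
have u0 : forall a, u a = 0.
  apply: free_k; rewrite ?sumZ //.
    apply: leq_trans le_hk; rewrite -[h]card_ord -(card_image c_inj).
    apply: subset_leq_card; apply/fintype.subsetP=> a; rewrite inE.
    apply: contraR => /negP a_notin; apply/eqP; rewrite /u big_pred0 // => j.
    by apply/negP=> /eqP ja; apply: a_notin; rewrite -ja fintype.image_f.
  transitivity (\sum_j y 0 j); first by rewrite [RHS](partition_big c xpredT).
  have := congr1 (fun z : 'rV_1 => z 0 0) E1; rewrite summxE [RHS]mxE.
  move=> E0; rewrite -[RHS]E0; apply: eq_bigr => j _.
  by rewrite !mxE mulr1.
by apply/rowP=> j; rewrite mxE -u_c u0.
Qed.

(** An affine form is a linear form plus a constant. Affine forms take all systems
    of values on [h <= k] of the points, uniformly often since evaluation is a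
    surjective morphism; a shift-invariant function does not see the constant.
    The alphabet is Z/(pdiv q) because this is what the prime field 'F_q is by
    definition. *)
Lemma balanced_affinely_free (R : realType) k : affinely_free k ->
  @balanced R (pdiv q) k C 'rV['F_q]_r (fun=> #|{: 'rV['F_q]_r}|%:R^-1)
    (fun v c => (v *m (pt c)^T) 0 0).
Proof.
move=> free_k; split=> [v||h c P le_hk c_inj P_shift].
- by rewrite invr_ge0 ler0n.
- rewrite sumr_const -[LHS]mulr_natl mulfV // pnatr_eq0 -lt0n.
  by apply/card_gt0P; exists 0.
rewrite -mulr_sumr mulrC.
pose x (v : 'rV['F_q]_r) : {ffun 'I_h -> 'F_q} := [ffun j => (v *m (pt (c j))^T) 0 0].
rewrite -/(mean (fun v => P (x v))).
(* Averaging over linear forms is averaging over affine forms, the constant being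
   the first coordinate of the longer row. *)
rewrite -(@mean_surj _ 'rV['F_q]_(1 + r) _ rsubmx); first last.
- by move=> v; exists (row_mx 0 v); rewrite row_mxKr.
- exact: linearD.
pose A := \matrix_(j < h) row_mx (const_mx 1 : 'rV['F_q]_1) (pt (c j)).
pose phi (u : 'rV_(1 + r)) : {ffun 'I_h -> 'F_q} := [ffun j => (u *m A^T) 0 j].
have phiE u j : phi u j = lsubmx u 0 0 + x (rsubmx u) j.
  rewrite !ffunE -[u in LHS]hsubmxK.
  transitivity ((row_mx (lsubmx u) (rsubmx u) *m (row j A)^T) 0 0).
    by rewrite !mxE; apply: eq_bigr => i _; rewrite !mxE.
  rewrite rowK tr_row_mx mul_row_col mxE; congr (_ + _).
  by rewrite mxE big_ord1 !mxE mulr1.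
rewrite -(@mean_surj _ 'rV['F_q]_(1 + r) {ffun 'I_h -> 'F_q} phi).
- congr (_ / _); apply: eq_bigr => u _.
  rewrite -(P_shift (x (rsubmx u)) (lsubmx u 0 0)); congr P.
  by apply/ffunP=> j; rewrite phiE ffunE addrC.
- by move=> u v; apply/ffunP=> j; rewrite !ffunE mulmxDl mxE.
have /row_freeP[B AB] := affine_extension_row_free _ _ _ free_k le_hk c_inj.
move=> z; exists ((\row_j z j) *m B^T); apply/ffunP=> j.
by rewrite ffunE -mulmxA -trmx_mul AB trmx1 mulmx1 mxE.
Qed.

End Affine.
Arguments affinely_free {q C r} pt k.

(** The alphabet sizes [p] and [pdiv q] are linked by an equation only, so that
    for a prime [q] the lemma applies to instances over Z/q as well. *)
Lemma affine_ratio_ge (R : realType) (q p k : nat) (I : csp_instance R p k)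
    (C : finType) (r : nat) (pt : C -> 'rV['F_q]_r) :
    (1 < q)%N -> p = pdiv q -> csp_Eq I -> opt I != wor I ->
    (strong_chromatic_number I <= #|C|)%N -> affinely_free pt k ->
  1 / p%:R ^+ r <= average_differential_ratio I.
Proof.
move=> q_gt1 p_eq; move: I; rewrite p_eq => I hE hI nu_le free_k.
have := ratio_ge _ _ _ I hE _ _ _ _ 0 hI nu_le (balanced_affinely_free _ _ _ _ R _ free_k).
have -> : #|{: 'rV['F_q]_r}| = (pdiv q ^ r)%N.
  rewrite card_mx mul1n; congr (_ ^ _)%N; rewrite card_ord.
  by rewrite Zp_cast // prime_gt1 // pdiv_prime.
rewrite natrX div1r; apply => c; by rewrite mul0mx mxE.
Qed.

(** * Point configurations *)

Definition parity_point (r : nat) (c : 'I_r + bool) : 'rV['F_2]_r :=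
  match c with inl i => delta_mx 0 i | inr b => const_mx b%:R end.

(** Reading a relation on the basis shows that all coefficients agree with the
    one of the all-one vector up to sign, so a nontrivial relation involves all
    [r + 2] points. *)
Lemma parity_points_free r : ~~ odd r ->
  affinely_free (parity_point r) r.+1.
Proof.
move=> r_even u supp_u.
rewrite !big_sumType /= !big_bool /= scaler0 addr0 => sum0 rel0.
set a := u (inr true) in sum0 rel0.
have u_inl i : u (inl i) = - a.
  apply/eqP; rewrite -addr_eq0; move/rowP/(_ i): rel0.
  rewrite !mxE summxE (bigD1 i) //= big1 => [|j ne_ji].
    by rewrite !mxE !eqxx !mulr1 addr0 => ->.
  by rewrite !mxE eqxx (eq_sym i) (negPf ne_ji) mulr0.
have r0 : r%:R = 0 :> 'F_2.
  rewrite -(odd_double_half r) (negPf r_even) add0n -muln2 natrM.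
  by rewrite (_ : 2%:R = 0) ?mulr0 //; apply: val_inj.
have u_false : u (inr false) = - a.
  apply/eqP; rewrite -addr_eq0 addrC; move: sum0.
  rewrite (eq_bigr (fun=> - a)) // sumr_const card_ord.
  by rewrite -mulr_natr r0 mulr0 add0r => ->.
have a0 : a = 0.
  apply/eqP; apply: contraLR supp_u => a_neq0; rewrite -ltnNge.
  rewrite (eq_card (B := predT)) => [|[i|[]]]; rewrite ?inE ?u_inl ?u_false ?oppr_eq0 //.
  by rewrite card_sum card_ord card_bool addn2.
by case=> [i|[]]; rewrite ?u_inl ?u_false -/a a0 ?oppr0.
Qed.

Section BCHPoints.
Variables (q : nat) (K : finFieldType) (charKq : q \in [pchar K]).
Let L := pPrimeCharType charKq.

Definition bch_exponents (k : nat) : seq nat :=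
  [seq j <- iota 1 k.-1 | ~~ (q %| j)%N].

(** The columns of the parity-check matrix of a BCH code of length [#|K|], the
    powers being written in coordinates over the prime field. *)
Definition bch_point (k : nat) (a : K) :
    'rV['F_q]_(size (bch_exponents k) * dim L) :=
  mxvec (\matrix_(i < size (bch_exponents k)) v2r ((a : L) ^+ nth 0%N (bch_exponents k) i)).

(** The coefficients are fixed by the Frobenius automorphism as they lie in the
    prime field. *)
Lemma power_sum_frobenius (u : L -> 'F_q) j :
  (\sum_a u a *: a ^+ j) ^+ q = \sum_a u a *: a ^+ (j * q).
Proof.
have charL : q \in [pchar L] by exact: charKq.
have q_pr : prime q := pcharf_prime charKq.
rewrite -(pFrobenius_autE charL) raddf_sum; apply: eq_bigr => a _.
rewrite /= pFrobenius_autE exprZn exprM; congr (_ *: _).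
by rewrite -[RHS]expf_card card_Fp.
Qed.

(** The relation extends linearly from monomials to polynomials of degree less
    than [k]; one that vanishes on the whole support except at [a0] isolates the
    coefficient of [a0]. *)
Lemma eq0_of_power_sums k (u : L -> 'F_q) :
    (#|[pred a | u a != 0%R]| <= k)%N ->
    (forall j, (j < k)%N -> \sum_a u a *: a ^+ j = 0) -> forall a, u a = 0.
Proof.
move=> supp_u power_sums a0; apply/eqP; apply: contraT => ua0.
pose p := \prod_(a | (u a != 0) && (a != a0)) ('X - a%:P).
have size_p : (size p <= k)%N.
  rewrite /p -big_filter size_prod_XsubC size_filter -sum1_count sum1dep_card.
  apply: leq_trans supp_u; rewrite (cardD1 a0 [pred a | u a != 0%R]) inE ua0.
  by rewrite ltnS; apply: eq_leq; apply: eq_card => a; rewrite !inE andbC.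
have : \sum_a u a *: p.[a] = 0.
  under eq_bigr do rewrite (horner_coef_wide _ size_p) scaler_sumr.
  rewrite exchange_big big1 //= => i _.
  under eq_bigr do rewrite scalerAr.
  by rewrite -mulr_sumr power_sums ?mulr0.
rewrite (bigD1 a0) //= big1 ?addr0 => [|a ne_a].
  move/eqP; rewrite scaler_eq0 (negPf ua0) /= /p horner_prod.
  rewrite prodf_seq_eq0 => /hasP[a _ /= /andP[/andP[_ ne_a]]].
  by rewrite hornerXsubC subr_eq0 eq_sym (negPf ne_a).
have [->|ua] := eqVneq (u a) 0; first by rewrite scale0r.
rewrite /p horner_prod (bigD1 a) ?ua //=.
by rewrite hornerXsubC subrr mul0r scaler0.
Qed.

(** By strong induction on the exponent, all power sums below [k] vanish: the
    constant one by the condition on the sum of the coefficients, the kept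
    exponents by the relation itself, and the multiples of [q] by Frobenius. *)
Lemma bch_points_free k : affinely_free (bch_point k) k.
Proof.
move=> u supp_u sum0 rel0.
have q_pr : prime q := pcharf_prime charKq.
have q_gt1 := prime_gt1 q_pr.
apply: (eq0_of_power_sums k u supp_u).
elim/ltn_ind=> j IH lt_jk.
have [->|j_gt0] := posnP j.
  by under eq_bigr do rewrite expr0; rewrite -scaler_suml sum0 scale0r.
have [/dvdnP[j' jE]|nqj] := boolP (q %| j)%N.
  have lt_j' : (j' < j)%N by rewrite jE in j_gt0 *; nia.
  rewrite jE -power_sum_frobenius IH // ?(ltn_trans lt_j') //.
  by rewrite expr0n eqn0Ngt prime_gt0.
have j_in : j \in bch_exponents k.
  by rewrite mem_filter nqj mem_iota j_gt0 /=; lia.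
have lt_i : (index j (bch_exponents k) < size (bch_exponents k))%N.
  by rewrite index_mem.
apply: (can_inj v2rK); rewrite linear0 linear_sum /=.
move/(congr1 vec_mx)/(congr1 (row (Ordinal lt_i))): rel0.
rewrite linear0 row0 linear_sum linear_sum /= => E; rewrite -[RHS]E.
apply: eq_bigr => a _; rewrite !linearZ /= mxvecK rowK /=.
by rewrite nth_index.
Qed.

End BCHPoints.

Lemma size_bch_exponents (q k : nat) :
  (0 < q)%N -> size (bch_exponents q k) = (k.-1 - k.-1 %/ q)%N.
Proof.
move=> q_gt0; rewrite /bch_exponents size_filter.
have -> : (k.-1 %/ q = count (dvdn q) (iota 1 k.-1))%N.
  rewrite divn_count_dvd -sum1_count [RHS]big_mkcond /index_iota subn1 /=.
  by apply: eq_bigr => j _; case: (q %| j)%N.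
by rewrite -[X in (X - _)%N](size_iota 1 k.-1) -(count_predC (dvdn q)) addKn.
Qed.

(** The field is the smallest one, of cardinal a power of [q], that has enough
    elements for all the colours. *)
Lemma bch_ratio_ge (R : realType) (q k : nat) (I : csp_instance R q k) :
    prime q -> csp_Eq I -> opt I != wor I -> (1 < strong_chromatic_number I)%N ->
  1 / q%:R ^+ (up_log q (strong_chromatic_number I) * (k.-1 - k.-1 %/ q))
    <= average_differential_ratio I.
Proof.
move=> q_pr hE hI nu_gt1; set nu := strong_chromatic_number I in nu_gt1 *.
have q_gt1 := prime_gt1 q_pr.
have s_gt0 : (0 < up_log q nu)%N by rewrite up_log_gt0 q_gt1.
have [K charKq cardK] := pPrimePowerField q_pr s_gt0.
have nu_le : (nu <= #|K|)%N by rewrite cardK up_logP.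
have := affine_ratio_ge _ _ _ _ _ _ _ _ q_gt1 (esym (pdiv_id q_pr)) hE hI nu_le
  (bch_points_free _ _ charKq k).
set L := pPrimeCharType charKq.
have dimL : dim L = up_log q nu.
  apply/eqP; rewrite -(eqn_exp2l _ _ q_gt1) -cardK -(mul1n (dim L)).
  have q_eq : q = #|'F_q| by rewrite card_Fp.
  rewrite [X in (X ^ _)%N]q_eq -card_mx.
  by apply/eqP; apply/esym/(@bij_eq_card L _ v2r); exists r2v; [exact: v2rK | exact: r2vK].
by rewrite dimL size_bch_exponents ?prime_gt0 // mulnC.
Qed.

(** * Binary families of strength three *)

Lemma sum_option (V : nmodType) (T : finType) (F : option T -> V) :
  \sum_t F t = F None + \sum_t F (Some t).
Proof.
rewrite (bigD1 None) //=; congr (_ + _).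
by rewrite (reindex_omap Some id) => [|[t|]] //=; apply: eq_bigl => t; rewrite eqxx.
Qed.

Section Correlations.
Variable R : realType.

(** The nontrivial character of Z/2. *)
Definition spin (y : 'Z_2) : R := if y == 0 then 1 else -1.

Lemma Z2_ind (A : 'Z_2 -> Prop) : A 0 -> A 1 -> forall y, A y.
Proof.
move=> A0 A1 [[|[|]] // y_lt].
- by rewrite (_ : Ordinal y_lt = 0) //; apply: val_inj.
- by rewrite (_ : Ordinal y_lt = 1) //; apply: val_inj.
Qed.

Lemma spinD y z : spin (y + z) = spin y * spin z.
Proof. by move: y z; do 2!apply: Z2_ind; rewrite /spin /= ?mul1r ?mulr1 ?mulrNN ?mulr1. Qed.

(** Flipping coordinate [i] changes the sign of the summand. *)
Lemma mean_spin_pair h (i j : 'I_h) : i != j ->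
  mean (fun z : {ffun 'I_h -> 'Z_2} => spin (z i) * spin (z j)) = 0.
Proof.
move=> ne_ij; rewrite /mean.
set S := \sum_z _; suff -> : S = 0 by rewrite mul0r.
have : S = - S.
  rewrite {1}/S (reindex_inj (addIr [ffun l => if l == i then 1 else 0])).
  rewrite -sumrN; apply: eq_bigr => z _; rewrite !ffunE eqxx eq_sym (negPf ne_ij).
  by rewrite addr0 spinD {2}/spin /= mulrN1 mulNr.
by lra.
Qed.

(** Shift-invariance leaves only the characters on an even number of coordinates
    in the Fourier expansion, and with at most three coordinates these are the
    constants and the products of two spins. *)
Lemma shift_invariant_spin_pairs h (P : {ffun 'I_h -> 'Z_2} -> R) :
    (h <= 3)%N -> shift_invariant P ->
  exists a (B : 'I_h -> 'I_h -> R),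
    forall z, P z = a + \sum_i \sum_(j | i != j) B i j * (spin (z i) * spin (z j)).
Proof.
move=> h_le3 P_shift.
case: h P h_le3 P_shift => [|h] P h_le3 P_shift.
  exists (P 0), (fun _ _ => 0) => z; rewrite big_ord0 addr0.
  by congr P; apply/ffunP; case.
have base z : P z = P [ffun j => z j - z ord0].
  by rewrite -(P_shift z (- z ord0)).
have spin_sq y : spin y * spin y = 1 by rewrite -spinD; move: y; apply: Z2_ind.
have spinB y z : spin (y - z) = spin y * spin z.
  by rewrite spinD; congr (_ * _); move: z; apply: Z2_ind.
case: h P h_le3 P_shift base => [|[|[|//]]] P h_le3 P_shift base.
- exists (P 0), (fun _ _ => 0) => z; rewrite base !big_ord_recl !big_ord0.
  rewrite !addr0; rewrite big1 ?addr0 => [|j _]; last by rewrite mul0r.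
  by congr P; apply/ffunP=> j; rewrite !ffunE (ord1 j) subrr.
(* In the last two cases Q lists the values at inputs with first coordinate 0, and
   its Fourier coefficients are attached to the pairs i < j; the other pairs get
   the default value 0 of nth. *)
- pose o1 : 'I_2 := lift ord0 ord0.
  pose Q y := P [ffun j : 'I_2 => nth 0 [:: 0; y] j].
  have QE : forall y, Q y = (Q 0 + Q 1) / 2 + (Q 0 - Q 1) / 2 * spin y.
    by apply: Z2_ind; rewrite /spin /=; lra.
  exists ((Q 0 + Q 1) / 2),
    (fun i j => nth 0 [:: nth 0 [:: 0; (Q 0 - Q 1) / 2] j] i) => z.
  have -> : P z = Q (z o1 - z ord0).
    rewrite base; congr P; apply/ffunP=> j; rewrite !ffunE.
    case: (unliftP ord0 j) => [j' ->|->]; last by rewrite subrr.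
    by rewrite (ord1 j').
  rewrite QE spinB; under [X in _ = _ + X]eq_bigr do rewrite big_mkcond.
  rewrite !big_ord_recl !big_ord0 /= -/o1; lra.
- pose o1 : 'I_3 := lift ord0 ord0; pose o2 : 'I_3 := lift ord0 (lift ord0 ord0).
  pose Q y y' := P [ffun j : 'I_3 => nth 0 [:: 0; y; y'] j].
  pose b := (Q 0 0 + Q 0 1 - Q 1 0 - Q 1 1) / 4.
  pose c := (Q 0 0 - Q 0 1 + Q 1 0 - Q 1 1) / 4.
  pose d := (Q 0 0 - Q 0 1 - Q 1 0 + Q 1 1) / 4.
  pose a := (Q 0 0 + Q 0 1 + Q 1 0 + Q 1 1) / 4.
  have QE : forall y y', Q y y' =
      a + b * spin y + c * spin y' + d * (spin y * spin y').
    by do 2!apply: Z2_ind; rewrite /spin /a /b /c /d /=; lra.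
  exists a, (fun i j => nth 0 (nth [::] [:: [:: 0; b; c]; [:: 0; 0; d]] i) j) => z.
  have -> : P z = Q (z o1 - z ord0) (z o2 - z ord0).
    rewrite base; congr P; apply/ffunP=> j; rewrite !ffunE.
    case: (unliftP ord0 j) => [j' ->|->]; last by rewrite subrr.
    case: (unliftP ord0 j') => [j'' ->|->] //.
    by rewrite (ord1 j'').
  rewrite QE !spinB; under [X in _ = _ + X]eq_bigr do rewrite big_mkcond.
  rewrite !big_ord_recl !big_ord0 /= -/o1 -/o2.
  by rewrite [spin _ * spin _ * (spin _ * _)]mulrACA spin_sq mulr1; lra.
Qed.

Lemma balanced_of_correlations (C T : finType) (w : T -> R) (x : T -> C -> 'Z_2) :
    (forall t, 0 <= w t) -> \sum_t w t = 1 ->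
    (forall a b, a != b -> \sum_t w t * (spin (x t a) * spin (x t b)) = 0) ->
  balanced 3 w x.
Proof.
move=> w_ge0 w_sum corr; split=> // h c P h_le3 c_inj P_shift.
have [a [B PE]] := shift_invariant_spin_pairs _ _ h_le3 P_shift.
have card_neq0 : #|{: {ffun 'I_h -> 'Z_2}}|%:R != 0 :> R.
  by rewrite pnatr_eq0 -lt0n; apply/card_gt0P; exists 0.
transitivity a.
  under eq_bigr do rewrite PE mulrDr.
  rewrite big_split /= -mulr_suml w_sum mul1r -[RHS]addr0; congr (_ + _).
  under eq_bigr do rewrite mulr_sumr.
  rewrite exchange_big big1 //= => i _.
  under eq_bigr do rewrite mulr_sumr.
  rewrite exchange_big big1 //= => j ne_ij.
  under eq_bigr do rewrite !ffunE mulrCA.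
  by rewrite -mulr_sumr corr ?mulr0 // (inj_eq c_inj).
apply/esym/(canLR (mulfK card_neq0)); under eq_bigr do rewrite PE.
rewrite big_split /= sumr_const mulr_natr -[RHS]addr0; congr (_ + _).
rewrite exchange_big big1 //= => i _; rewrite exchange_big big1 //= => j ne_ij.
rewrite -mulr_sumr; have /eqP := mean_spin_pair h i j ne_ij.
by rewrite mulf_eq0 invr_eq0 (negPf card_neq0) orbF => /eqP->; rewrite mulr0.
Qed.

Variables (n m : nat).
Hypotheses (m_gt0 : (0 < m)%N) (nE : n = m.*2).

(** The nonzero rows are all the rearrangements of a fixed row with as many zeros
    as ones. *)
Definition half_row (t : option {perm 'I_n}) (c : 'I_n) : 'Z_2 :=
  if t is Some s then (if (s c < m)%N then 1 else 0) else 0.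

Definition half_weight (t : option {perm 'I_n}) : R :=
  if t is Some s then (1 - n%:R^-1) / #|{perm 'I_n}|%:R else n%:R^-1.

(** The correlation is the same for all pairs of distinct columns by symmetry, and
    the columns sum to zero as spins, which relates it to the correlation of a
    column with itself. *)
Lemma half_correlation (a b : 'I_n) : a != b ->
  \sum_(s : {perm 'I_n}) spin (half_row (Some s) a) * spin (half_row (Some s) b)
    = - #|{perm 'I_n}|%:R / (n%:R - 1).
Proof.
pose g (c : 'I_n) := spin (if (c < m)%N then 1 else 0).
pose N a b := \sum_(s : {perm 'I_n}) g (s a) * g (s b).
rewrite -[LHS]/(N a b) => ne_ab.
have Naa : N a a = #|{perm 'I_n}|%:R.
  rewrite -sumr_const; apply: eq_bigr => s _.
  by rewrite /g /spin; case: ifP; rewrite /= ?mulr1 ?mulrNN ?mulr1.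
have Nab c : c != a -> N a c = N a b.
  move=> ne_ca; rewrite /N (reindex_inj (mulgI (tperm b c))).
  by apply: eq_bigr => s _; rewrite !permM tpermD ?tpermR // eq_sym.
have sum_g : \sum_c g c = 0.
  rewrite -(big_mkord xpredT (fun c => spin (if (c < m)%N then 1 else 0))).
  rewrite (@big_cat_nat _ _ _ m) //=; last by lia.
  rewrite (eq_big_nat _ _ (F2 := fun=> -1)) => [|c /andP[_ ->] //].
  rewrite [X in _ + X](eq_big_nat _ _ (F2 := fun=> 1)) => [|c]; last first.
    by rewrite leqNgt => /andP[/negPf->].
  rewrite !sumr_const_nat subn0 mulNrn (_ : n - m = m)%N ?addNr //; lia.
have : \sum_c N a c = 0.
  rewrite /N exchange_big big1 //= => s _.
  by rewrite -mulr_sumr -(reindex_inj (@perm_inj _ s) (P := xpredT) (F := g)) sum_g mulr0.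
rewrite (bigD1 a) //= Naa (eq_bigr (fun=> N a b)) //.
rewrite sumr_const cardC1 card_ord -[N a b *+ _]mulr_natr -subn1 natrB; last by lia.
move=> E; have nR : n%:R - 1 != 0 :> R by rewrite subr_eq0 pnatr_eq1; lia.
by apply: (canRL (mulfK nR)); apply/eqP; rewrite -addr_eq0 addrC E.
Qed.

(** The weight [1/n] of the zero row is the one that cancels the correlation
    [-1/(n - 1)] of the other rows. *)
Lemma half_rows_balanced : balanced 3 half_weight half_row.
Proof.
have n_gt1 : (1 < n)%N by lia.
have nR : 1 < n%:R :> R by rewrite ltr1n.
have card_neq0 : #|{perm 'I_n}|%:R != 0 :> R.
  by rewrite pnatr_eq0 -lt0n; apply/card_gt0P; exists 1%g.
apply: balanced_of_correlations.
- case=> [s|] /=; last by rewrite invr_ge0 ler0n.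
  by rewrite divr_ge0 ?ler0n // subr_ge0 invf_le1; lra.
- rewrite sum_option /= sumr_const -[X in _ + X]mulr_natr divfK //; lra.
move=> a b ne_ab; rewrite sum_option /= -mulr_sumr half_correlation //.
rewrite /spin /=; field; rewrite card_neq0 /=; apply/andP; split; lra.
Qed.

End Correlations.

(** * Numerical comparisons and conclusion *)

(** The powers [q], [q ^ 2], and so on below [k] are among the multiples of [q]
    that the exponents avoid. *)
Lemma up_log_le_bch (q k : nat) : (1 < q)%N -> (0 < k)%N ->
  (k.-1 - k.-1 %/ q <= k - up_log q k)%N.
Proof.
move=> q_gt1 k_gt0; set d := (k.-1 %/ q)%N.
have : (up_log q k <= d.+1)%N.
  apply: up_log_min => //; rewrite expnS.
  apply: (leq_trans (n := (q * d.+1)%N)).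
    by rewrite -(prednK k_gt0) mulnC ltn_ceil // ltnW.
  by rewrite leq_mul2l ltn_expl ?orbT.
by lia.
Qed.

Lemma expn_up_log_lt (q n : nat) : (1 < q)%N -> (1 < n)%N ->
  (q ^ up_log q n < q * n)%N.
Proof.
move=> q_gt1 n_gt1.
have s_gt0 : (0 < up_log q n)%N by rewrite up_log_gt0 q_gt1.
by rewrite -(prednK s_gt0) expnS ltn_pmul2l ?up_log_gtn // ltnW.
Qed.

Lemma inv_pow_up_log_ge (R : numFieldType) (q n e : nat) : (1 < q)%N -> (1 < n)%N ->
  1 / (q%:R * n%:R) ^+ e <= 1 / q%:R ^+ (up_log q n * e) :> R.
Proof.
move=> q_gt1 n_gt1; rewrite !div1r lef_pV2 ?posrE ?exprn_gt0 ?mulr_gt0 ?ltr0n //;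
  try by apply: ltnW.
rewrite exprM -natrX -natrM; apply: lerXn2r; rewrite ?nnegrE ?ler0n //.
by rewrite ler_nat ltnW // expn_up_log_lt.
Qed.

(** The difference of the two sequences is at most [1/v^2] in absolute value. *)
Lemma equiv_inv_double_uphalf (R : realType) :
  (fun v : nat => 1 / (2 * uphalf v)%:R : R^o)
    ~_\oo (fun v : nat => 1 / v%:R : R^o).
Proof.
apply/eqaddoP => e e_gt0; near=> v.
have v_gt0 : (0 < v)%N by near: v; exists 1%N.
have v_big : e^-1 <= v%:R.
  by near: v; apply: nbhs_infty_ger.
set u := (2 * uphalf v)%N.
have vR : 0 < v%:R :> R by rewrite ltr0n.
have le_vu : (v <= u)%N by rewrite /u; lia.
have le_uv : (u <= v + 1)%N by rewrite /u; lia.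
have uR : v%:R <= u%:R :> R by rewrite ler_nat.
have uvR : u%:R <= v%:R + 1 :> R by rewrite natr1 ler_nat -addn1.
rewrite /= !fctE /=.
have -> : 1 / u%:R - 1 / v%:R = - ((u%:R - v%:R) / (u%:R * v%:R)) :> R.
  by field; apply/andP; split; lra.
rewrite normrN !ger0_norm ?divr_ge0 ?mulr_ge0 ?ler0n //; [|lra].
rewrite ler_pdivrMr ?mulr_gt0 //; [|lra].
have -> : e * (1 / v%:R) * (u%:R * v%:R) = e * u%:R by field; lra.
have : 1 <= e * v%:R by rewrite mulrC -ler_pdivrMr ?div1r.
have : e * v%:R <= e * u%:R by rewrite ler_pM2l.
by lra.
Unshelve. all: by end_near. Qed.

Theorem corollary2p8 (R : realType) (q k : nat) (hq : prime q) (hk : (3 <= k)%N)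
    (I : csp_instance R q k) (hE : csp_Eq I) (hI : opt I != wor I)
    (nu : nat) (hnu : nu = strong_chromatic_number I) (hnuk : (k <= nu)%N) :
  (q = 2%N -> odd k ->
    [/\ (nu <= k + 1)%N -> 1 / 2 ^+ (k - 1) <= average_differential_ratio I,
        k = 3%N ->
          1 / (2 * uphalf nu)%:R <= average_differential_ratio I /\
          (fun v : nat => 1 / (2 * uphalf v)%:R : R^o)
            ~_\oo (fun v : nat => 1 / v%:R : R^o) &
        (5 <= k)%N ->
          1 / 2 ^+ (up_log 2 nu * (k - 1) %/ 2) <= average_differential_ratio I /\
          1 / (2 * nu%:R) ^+ (k %/ 2) <= 1 / 2 ^+ (up_log 2 nu * (k - 1) %/ 2) :> R])
  /\
  ((3 <= q)%N ->
    1 / q%:R ^+ (up_log q nu * (k - up_log q k)) <= average_differential_ratio I /\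
    1 / (q%:R * nu%:R) ^+ (k - up_log q k)
      <= 1 / q%:R ^+ (up_log q nu * (k - up_log q k)) :> R).
Proof.
have q_gt1 := prime_gt1 hq.
have nu_gt1 : (1 < nu)%N by lia.
have bch : 1 / q%:R ^+ (up_log q nu * (k.-1 - k.-1 %/ q))
    <= average_differential_ratio I.
  by move: nu_gt1; rewrite hnu => nu_gt1; apply: bch_ratio_ge.
split=> [q2 k_odd|_]; last first.
  split; last exact: inv_pow_up_log_ge.
  apply: le_trans bch; rewrite !div1r lef_pV2 ?posrE ?exprn_gt0 ?ltr0n //; try by apply: ltnW.
  by rewrite ler_eXn2l ?ltr1n // leq_mul2l up_log_le_bch ?orbT //; lia.
subst q; split=> [nu_le|k3|_].
- have k_eq : k = (k - 1).+1 by lia.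
  apply: (@affine_ratio_ge _ 2 2 _ I _ _ (parity_point (k - 1))) => //.
    by rewrite -hnu card_sum card_ord card_bool; lia.
  by rewrite [X in affinely_free _ X]k_eq; apply: parity_points_free; lia.
- split; last exact: equiv_inv_double_uphalf.
  subst k.
  have m_gt0 : (0 < uphalf nu)%N by lia.
  have := half_rows_balanced R _ _ m_gt0 (mul2n _).
  move=> bal; rewrite div1r.
  apply: (ratio_ge _ _ _ _ hE _ _ _ _ None hI _ bal) => //.
  by rewrite -hnu card_ord; lia.
- have -> : (up_log 2 nu * (k - 1) %/ 2 = up_log 2 nu * (k %/ 2))%N.
    by rewrite -muln_divA; [congr (_ * _)%N; lia | lia].
  split; last exact: inv_pow_up_log_ge.
  have <- : (k.-1 - k.-1 %/ 2 = k %/ 2)%N by lia.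
  exact: bch.
Qed.
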